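(* Let $R$ be an E-ring and let $J$ be an E-ideal of $R$. Then $J$ is E-radical (i.e. $J=\operatorname{E-rad}(J)$) if and only if for every $a,b_1,b_2\in R$: if $b_1\cdot b_2\in J$ and $a\in\sqrt[E]{Jb_1}\cap\sqrt[E]{Jb_2}$, then $a\in J$.
   Context: An E-ring is a pair $(R,E)$ where $R$ is a commutative ring with $1$, assumed to be a $\mathbb{Q}$-algebra, and $E:(R,+)\to(R^*,\cdot)$ is a group homomorphism. An E-ideal is an ideal $I$ such that $\alpha\in I$ implies $E(\alpha)-1\in I$; it is prime if it is prime as an ideal. For $X\subseteq R$, $(X)^E$ denotes the E-ideal of $R$ generated by $X$. For $X\subseteq R$ and $b\in R$, $Xb$ denotes $X\cup\{b\}$. $\operatorname{E-rad}(J)$ is the intersection of all prime E-ideals of $R$ containing $J$ (equal to $R$ if there are none). The operators $\sqrt[n]{\ }$ on subsets of $R$, for $n\in\mathbb{N}$, are defined inductively by $$\sqrt[0]{X}=(X)^E,\qquad \sqrt[n+1]{X}=\sqrt[n]{\{a\in R:\ \exists\, b_1,b_2\in R\ \text{ with } b_1b_2\in\sqrt[n]{X}\ \text{and}\ a\in\sqrt[n]{Xb_1}\cap\sqrt[n]{Xb_2}\}},$$ and $\sqrt[E]{X}:=\bigcup_{n\in\mathbb{N}}\sqrt[n]{X}$. *)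

(* Defs.v *)
From mathcomp Require Import all_boot all_order all_algebra.
From mathcomp Require Import boolp classical_sets.

Set Implicit Arguments.
Unset Strict Implicit.
Unset Printing Implicit Defensive.

Import GRing.Theory.
Local Open Scope classical_set_scope.
Local Open Scope ring_scope.

(* The zero ring is allowed, hence comPzRingType; as algType requires 1 != 0,
   the Q-algebra structure is given by its structure morphism from rat.
   Similarly unitRingType requires 1 != 0, so units are spelled out.
   [expE 0 = 1] follows from [expE_unit] and [expED]. *)
Record eRingType := ERing {
  eRing_sort :> comPzRingType;
  eRing_rat : {rmorphism rat -> eRing_sort};
  expE : eRing_sort -> eRing_sort;
  expE_unit : forall x, exists y, expE x * y = 1;
  expED : {morph expE : x y / x + y >-> x * y}
}.
Arguments expE {e} x.

(* Not [idealr_closed], which requires 1 \notin I: the whole ring is an ideal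
   here, and properness is only asked of prime ideals. *)
Definition ideal (R : comPzRingType) (I : set R) : Prop :=
  [/\ I 0,
      forall x y, I x -> I y -> I (x + y) &
      forall r x, I x -> I (r * x)].

Definition prime_ideal (R : comPzRingType) (P : set R) : Prop :=
  [/\ ideal P, ~ P 1 & forall x y, P (x * y) -> P x \/ P y].

Section ERing.
Variable R : eRingType.
Implicit Types (I J P X : set R) (n : nat).

Definition e_ideal I : Prop := ideal I /\ forall x, I x -> I (expE x - 1).

Definition prime_e_ideal P : Prop := prime_ideal P /\ e_ideal P.

Definition e_ideal_gen X : set R := smallest e_ideal X.

(* The intersection over the empty family is the whole ring. *)
Definition e_rad J : set R :=
  \bigcap_(P in [set P | prime_e_ideal P /\ J `<=` P]) P.

Definition e_radical J : Prop := J = e_rad J.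

Fixpoint e_nroot n X : set R :=
  if n is m.+1 then
    e_nroot m [set a | exists b1 b2 : R,
      e_nroot m X (b1 * b2) /\
      (e_nroot m (X `|` [set b1]) `&` e_nroot m (X `|` [set b2])) a]
  else e_ideal_gen X.

Definition e_root X : set R := \bigcup_n e_nroot n X.

End ERing.

(* Main.v *)
Require Import Defs.
From mathcomp Require Import all_boot all_order all_algebra.
From mathcomp Require Import boolp classical_sets.

Local Open Scope classical_set_scope.
Local Open Scope ring_scope.

(** Call a set [J] splitting closed when [b1 * b2 \in J] and membership of [a]
    in the E-roots of both [J + b1] and [J + b2] force [a \in J]; the theorem
    says that, among E-ideals, this is the same as being E-radical.

    A prime E-ideal [P] containing [X] contains the E-root of [X]
    ([e_root_sub_prime]): in each round of the inductive definition [P] contains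
    one of the two factors [b1], [b2], hence the element that the split
    produces. So an intersection of prime E-ideals is splitting closed.

    Conversely, let [J] be splitting closed and [a \notin J]. A prime E-ideal
    that contains [J] and avoids [a] is found as a maximal element [P] among the
    splitting closed sets that contain [J] and avoid [a]
    ([prime_e_ideal_avoiding]). If [b1 * b2 \in P] with neither factor in [P],
    then the E-roots of [P + b1] and [P + b2], being splitting closed
    ([splitting_closed_root]), both contain [a] by maximality; but [P] is
    splitting closed, so [a \in P].

    Zorn's lemma applies, and E-roots are splitting closed, because all the
    operators involved commute with directed unions ([e_nroot_bigcup]).
    The second fact also uses that iterated roots are absorbed by a single root
    of higher order ([e_nroot_comp]). *)

(** Directedness concerns the sets [F i] rather than an order on the indices, so
    that the image of a family by a monotone operator keeps the same indices. *)
Definition directed_family {T I : Type} (D : set I) (F : I -> set T) : Prop :=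
  D !=set0 /\
  forall i j, D i -> D j -> exists2 k, D k & F i `<=` F k /\ F j `<=` F k.

Lemma directed_family_image (T U I : Type) (D : set I) (F : I -> set T)
    (op : set T -> set U) :
  (forall X Y, X `<=` Y -> op X `<=` op Y) ->
  directed_family D F -> directed_family D (fun i => op (F i)).
Proof.
move=> opS [D0 dirF]; split=> // i j Di Dj.
have [k Dk [Fik Fjk]] := dirF i j Di Dj.
by exists k => //; split; apply: opS.
Qed.

Section ERingRoots.
Variable R : eRingType.
Implicit Types (J P X Y : set R) (m n : nat).

(** * E-ideals *)

Lemma e_ideal_bigcup I (D : set I) (F : I -> set R) :
  directed_family D F -> (forall i, D i -> e_ideal (F i)) ->
  e_ideal (\bigcup_(i in D) F i).
Proof.
move=> [[i0 Di0] dirF] idF; split; first split.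
- by exists i0 => //; have [[]] := idF _ Di0.
- move=> x y [i Di Fix] [j Dj Fjy]; have [k Dk [Fik Fjk]] := dirF i j Di Dj.
  have [[_ addF _] _] := idF _ Dk.
  by exists k => //; apply: addF; [exact: Fik | exact: Fjk].
- move=> r x [i Di Fix]; have [[_ _ mulF] _] := idF _ Di.
  by exists i => //; apply: mulF.
- by move=> x [i Di Fix]; have [_ expF] := idF _ Di; exists i => //; apply: expF.
Qed.

Lemma e_ideal_e_ideal_gen X : e_ideal (e_ideal_gen X).
Proof.
split; first split.
- by move=> K [[[]]].
- by move=> x y Xx Xy K HK; have [[[_ addK _] _] _] := HK; apply: addK;
    [exact: Xx | exact: Xy].
- by move=> r x Xx K HK; have [[[_ _ mulK] _] _] := HK; apply: mulK; exact: Xx.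
- by move=> x Xx K HK; have [[_ expK] _] := HK; apply: expK; exact: Xx.
Qed.

(** * Roots of finite order *)

(** The elements adjoined to [X] in the last round of a root of order [n.+1]. *)
Definition split_set n X : set R :=
  [set a | exists b1 b2 : R,
    e_nroot n X (b1 * b2) /\
    (e_nroot n (X `|` [set b1]) `&` e_nroot n (X `|` [set b2])) a].

Lemma e_nrootS n X : e_nroot n.+1 X = e_nroot n (split_set n X).
Proof. by []. Qed.

Lemma e_ideal_e_nroot n X : e_ideal (e_nroot n X).
Proof.
elim: n X => [|n IHn] X; first exact: e_ideal_e_ideal_gen.
by rewrite e_nrootS; exact: IHn.
Qed.

Lemma split_set_mono n :
  (forall X Y, X `<=` Y -> e_nroot n X `<=` e_nroot n Y) ->
  forall X Y, X `<=` Y -> split_set n X `<=` split_set n Y.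
Proof.
move=> rootS X Y XY a [b1 [b2 [b12 [a1 a2]]]]; exists b1, b2.
split; first exact: rootS b12.
by split; [apply: rootS a1 | apply: rootS a2]; apply: setSU.
Qed.

Lemma e_nroot_mono n X Y : X `<=` Y -> e_nroot n X `<=` e_nroot n Y.
Proof.
elim: n X Y => [|n IHn] X Y XY.
  by move=> x Xx K [idK YK]; apply: Xx; split=> //; apply: subset_trans YK.
by rewrite !e_nrootS; apply/IHn/split_set_mono.
Qed.

(** The splitting of [0] as [0 * 0] adjoins everything already obtained. *)
Lemma e_nroot_sub_split_set n X : e_nroot n X `<=` split_set n X.
Proof.
move=> a Xa; exists 0, 0; rewrite GRing.mul0r; split.
  by have [[]] := e_ideal_e_nroot n X.
by split; apply: e_nroot_mono Xa; exact: subsetUl.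
Qed.

Lemma sub_e_nroot n X : X `<=` e_nroot n X.
Proof.
elim: n X => [|n IHn] X; first by move=> x Xx K [_]; apply.
rewrite e_nrootS; apply: subset_trans (IHn _).
exact: subset_trans (IHn _) (@e_nroot_sub_split_set _ _).
Qed.

Lemma split_set_sub_e_nrootS n X : split_set n X `<=` e_nroot n.+1 X.
Proof. exact: sub_e_nroot. Qed.

Lemma e_nroot_leq m n X : (m <= n)%N -> e_nroot m X `<=` e_nroot n X.
Proof.
move=> /subnKC <-; elim: (n - m)%N => [|k IHk]; first by rewrite addn0.
rewrite addnS; apply: subset_trans IHk _.
apply: subset_trans (@e_nroot_sub_split_set _ _) _.
exact: split_set_sub_e_nrootS.
Qed.

(** Whether an element is in a root depends on finitely many elements of [X],
    which all lie in a single member of a directed family. *)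
Lemma e_nroot_bigcup n I (D : set I) (F : I -> set R) :
  directed_family D F ->
  e_nroot n (\bigcup_(i in D) F i) `<=` \bigcup_(i in D) e_nroot n (F i).
Proof.
elim: n F => [|n IHn] F dirF.
  move=> x; apply; split.
    apply: e_ideal_bigcup => [|i _]; last exact: e_ideal_e_ideal_gen.
    by apply: directed_family_image dirF; exact: (@e_nroot_mono 0%N).
  by move=> y [i Di Fiy]; exists i => //; exact: (@sub_e_nroot 0%N).
have dirFU b : directed_family D (fun i => F i `|` [set b]).
  apply: (directed_family_image _ _ _ _ _ (fun X => X `|` [set b])) dirF.
  by move=> X Y; exact: setSU.
have bigcupU1 b :
    (\bigcup_(i in D) F i) `|` [set b] `<=` \bigcup_(i in D) (F i `|` [set b]).
  move=> x [[i Di Fix]|xb]; first by exists i => //; left.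
  by have [[i Di] _] := dirF; exists i => //; right.
have split_bigcup :
    split_set n (\bigcup_(i in D) F i) `<=` \bigcup_(i in D) split_set n (F i).
  move=> a [b1 [b2 [b12 [a1 a2]]]].
  have [i Di Fib12] := IHn _ dirF _ b12.
  have [j Dj Fja1] := IHn _ (dirFU b1) _ (e_nroot_mono n _ _ (bigcupU1 b1) _ a1).
  have [k Dk Fka2] := IHn _ (dirFU b2) _ (e_nroot_mono n _ _ (bigcupU1 b2) _ a2).
  have [_ dir] := dirF.
  have [p Dp [Fip Fjp]] := dir i j Di Dj.
  have [q Dq [Fpq Fkq]] := dir p k Dp Dk.
  exists q => //; exists b1, b2; split.
    by apply: e_nroot_mono Fib12; apply: subset_trans Fpq.
  split; first by apply: e_nroot_mono Fja1; apply: setSU; apply: subset_trans Fpq.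
  by apply: e_nroot_mono Fka2; apply: setSU.
rewrite e_nrootS; apply: subset_trans (e_nroot_mono n _ _ split_bigcup) _.
apply: (IHn (fun i => split_set n (F i))).
by apply: directed_family_image dirF; apply: split_set_mono; exact: e_nroot_mono.
Qed.

Lemma e_nrootU1 n X (b : R) :
  e_nroot n X `|` [set b] `<=` e_nroot n (X `|` [set b]).
Proof.
rewrite subUset; split; first by apply: e_nroot_mono; exact: subsetUl.
by apply: subset_trans (@sub_e_nroot _ _); exact: subsetUr.
Qed.

(** The order of the absorbing root grows quickly with [m], but it does not
    depend on [X]; the induction needs this uniformity because it applies the
    hypothesis to [X] and to its extensions by the two factors of a split. *)
Lemma e_nroot_comp m n :
  exists k, forall X, e_nroot m (e_nroot n X) `<=` e_nroot k X.
Proof.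
elim: m n => [|m IHm] n.
  by exists n => X x; apply; split=> //; exact: e_ideal_e_nroot.
have [k Hk] := IHm n; have [l Hl] := IHm k.+1.
exists l => X; rewrite e_nrootS; apply: subset_trans (Hl X).
apply: e_nroot_mono; apply: subset_trans (@split_set_sub_e_nrootS _ _).
move=> a [b1 [b2 [b12 [a1 a2]]]]; exists b1, b2; split; first exact: Hk.
by split; apply: Hk; [apply: e_nroot_mono a1 | apply: e_nroot_mono a2];
  exact: e_nrootU1.
Qed.

(** * The E-root *)

Lemma e_root_mono X Y : X `<=` Y -> e_root X `<=` e_root Y.
Proof. by move=> XY x [n _ Xx]; exists n => //; apply: e_nroot_mono Xx. Qed.

Lemma sub_e_root X : X `<=` e_root X.
Proof. by move=> x Xx; exists 0%N => //; exact: sub_e_nroot. Qed.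

Lemma directed_e_nroot X : directed_family setT (fun n => e_nroot n X).
Proof.
split=> [|m n _ _]; first by exists 0%N.
by exists (maxn m n) => //; split; apply: e_nroot_leq;
  rewrite ?leq_maxl ?leq_maxr.
Qed.

Lemma e_ideal_e_root X : e_ideal (e_root X).
Proof.
apply: e_ideal_bigcup (directed_e_nroot X) _ => n _; exact: e_ideal_e_nroot.
Qed.

Lemma e_root_bigcupU1 I (D : set I) (F : I -> set R) (b : R) :
  directed_family D F ->
  e_root ((\bigcup_(i in D) F i) `|` [set b]) `<=`
  \bigcup_(i in D) e_root (F i `|` [set b]).
Proof.
move=> dirF a [n _ an].
have dirFU : directed_family D (fun i => F i `|` [set b]).
  apply: (directed_family_image _ _ _ _ _ (fun X => X `|` [set b])) dirF.
  by move=> X Y; exact: setSU.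
suff [i Di ai] : (\bigcup_(i in D) e_nroot n (F i `|` [set b])) a.
  by exists i => //; exists n.
apply: e_nroot_bigcup => //; apply: e_nroot_mono an => x [[i Di Fix]|xb].
  by exists i => //; left.
by have [[i Di] _] := dirF; exists i => //; right.
Qed.

Lemma e_root_sub_prime P X : prime_e_ideal P -> X `<=` P -> e_root X `<=` P.
Proof.
move=> [[idP P1 primeP] eidP] XP x [n _]; elim: n X XP x => [|n IHn] X XP.
  by move=> x; apply.
rewrite e_nrootS; apply: (IHn) => a [b1 [b2 [b12 [a1 a2]]]].
have [Pb|Pb] := primeP _ _ (IHn _ XP _ b12).
  by apply: IHn a1; rewrite subUset; split=> // _ ->.
by apply: IHn a2; rewrite subUset; split=> // _ ->.
Qed.

(** * Splitting closed sets *)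

Definition splitting_closed J : Prop :=
  forall a b1 b2 : R, J (b1 * b2) ->
    (e_root (J `|` [set b1]) `&` e_root (J `|` [set b2])) a -> J a.

(** Splitting [0] as [0 * 0] shows that [J] is its own E-root. So Zorn's lemma
    need only keep track of splitting closure, not of the ideal structure. *)
Lemma splitting_closed_e_ideal J : J 0 -> splitting_closed J -> e_ideal J.
Proof.
move=> J0 clJ; suff -> : J = e_root J by exact: e_ideal_e_root.
apply/seteqP; split=> [|a Ja]; first exact: sub_e_root.
apply: (clJ a 0 0); first by rewrite GRing.mul0r.
by split; apply: e_root_mono Ja; exact: subsetUl.
Qed.

Lemma splitting_closed_bigcup I (D : set I) (F : I -> set R) :
  directed_family D F -> (forall i, D i -> splitting_closed (F i)) ->
  splitting_closed (\bigcup_(i in D) F i).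
Proof.
move=> dirF clF a b1 b2 [i Di Fib12] [a1 a2].
have [j Dj Fja1] := e_root_bigcupU1 _ _ _ _ dirF _ a1.
have [k Dk Fka2] := e_root_bigcupU1 _ _ _ _ dirF _ a2.
have [_ dir] := dirF.
have [p Dp [Fip Fjp]] := dir i j Di Dj.
have [q Dq [Fpq Fkq]] := dir p k Dp Dk.
exists q => //; apply: (clF q Dq a b1 b2); first exact/Fpq/Fip.
split; first by apply: e_root_mono Fja1; apply: setSU; apply: subset_trans Fpq.
by apply: e_root_mono Fka2; apply: setSU.
Qed.

(** A split of an element over the E-root of [X] involves only roots of [X] of
    bounded order, hence is one of the splits of a later round. *)
Lemma splitting_closed_root X : splitting_closed (e_root X).
Proof.
have lower b a : e_root (e_root X `|` [set b]) a ->
    exists k, e_nroot k (X `|` [set b]) a.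
  move=> /(e_root_bigcupU1 _ _ _ _ (directed_e_nroot X)) [n _ [m _ am]].
  have [k Hk] := e_nroot_comp m n; exists k; apply: Hk.
  by apply: e_nroot_mono am; exact: e_nrootU1.
move=> a b1 b2 [i _ b12] [/lower [j a1] /lower [k a2]].
pose q := maxn i (maxn j k); exists q.+1 => //.
apply: split_set_sub_e_nrootS; exists b1, b2; split.
  by apply: e_nroot_leq b12; rewrite leq_maxl.
split; first by apply: e_nroot_leq a1; rewrite !leq_max leqnn orbT.
by apply: e_nroot_leq a2; rewrite !leq_max leqnn !orbT.
Qed.

(** Zorn's lemma is applied to the sets [A] for which [J + A], rather than [A],
    is splitting closed and avoids [a], so that the empty chain, whose union is
    the empty set, is bounded as well. *)
Lemma prime_e_ideal_avoiding J (a : R) :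
  J 0 -> splitting_closed J -> ~ J a ->
  exists P, [/\ prime_e_ideal P, J `<=` P & ~ P a].
Proof.
move=> J0 clJ nJa.
pose good A := splitting_closed (J `|` A) /\ ~ (J `|` A) a.
have [F goodF totF|A [[clA nAa] maxA]] := @Zorn_bigcup R good.
  pose D := [set set0] `|` F.
  have goodD A : D A -> good A.
    by case=> [->|/goodF//]; rewrite /good setU0.
  have dirD : directed_family D (fun A => J `|` A).
    split=> [|A B DA DB]; first by exists set0; left.
    have [AB|BA] : A `<=` B \/ B `<=` A.
      case: DA DB => [->|FA] [->|FB]; [left|left|right|exact: totF];
        exact: sub0set.
    - by exists B => //; split=> //; exact: setUS.
    - by exists A => //; split=> //; exact: setUS.
  have defJF : J `|` \bigcup_(A in F) A = \bigcup_(A in D) (J `|` A).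
    apply/seteqP; split=> x.
      case=> [Jx|[A FA Ax]]; first by exists set0; left.
      by exists A; right.
    move=> [A [->|FA]]; first by rewrite setU0; left.
    by case=> [Jx|Ax]; [left | right; exists A].
  rewrite /good defJF; split.
    by apply: splitting_closed_bigcup dirD _ => A /goodD [].
  by move=> [A /goodD [_]].
pose P := J `|` A.
have eidP : e_ideal P by apply: splitting_closed_e_ideal => //; left.
have [idP _] := eidP; have [_ _ mulP] := idP.
have rootPa b : ~ P b -> e_root (P `|` [set b]) a.
  move=> nPb; apply: contrapT => nroot_a.
  have subB : P `|` [set b] `<=` e_root (P `|` [set b]) := sub_e_root _.
  apply: (maxA (e_root (P `|` [set b]))); last first.
    rewrite /good (_ : J `|` _ = e_root (P `|` [set b])).
      by split=> //; exact: splitting_closed_root.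
    by apply/setUidPr => x Jx; apply: subB; left; left.
  split; first by move=> x Ax; apply: subB; left; right.
  by move=> BA; apply: nPb; right; apply: BA; apply: subB; right.
exists P; split=> //; last exact: subsetUl.
split=> //; split=> //.
  by move=> P1; apply: nAa; rewrite -[a]GRing.mulr1; exact: mulP.
move=> x y Pxy; apply: contrapT => nPxy; apply: nAa; apply: (clA a x y Pxy).
by split; apply: rootPa => Pb; apply: nPxy; [left | right].
Qed.

End ERingRoots.

Theorem corollary5p12 (R : eRingType) (J : set R) (hJ : e_ideal J) :
  e_radical J <->
  forall a b1 b2 : R,
    J (b1 * b2) ->
    (e_root (J `|` [set b1]) `&` e_root (J `|` [set b2])) a ->
    J a.
Proof.
split=> [radJ a b1 b2 b12 [a1 a2]|clJ].
  rewrite radJ => P [primeP JP]; have [[_ _ splitP] _] := primeP.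
  have [Pb|Pb] := splitP _ _ (JP _ b12).
    by apply: e_root_sub_prime a1 => //; rewrite subUset; split=> // _ ->.
  by apply: e_root_sub_prime a2 => //; rewrite subUset; split=> // _ ->.
apply/seteqP; split=> [x Jx P [_ JP]|a rad_a]; first exact: JP.
apply: contrapT => nJa; have [[J0 _ _] _] := hJ.
have [P [primeP JP nPa]] := prime_e_ideal_avoiding R J a J0 clJ nJa.
by apply: nPa; exact: rad_a.
Qed.
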